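(* Let $\mathfrak O$ be a compact DVR with residue field of size $q$, let $U$ be a finite set and let $A\in\mathrm{Mat}_{n\times m}(\mathfrak O[X_U])$ be a matrix of linear forms. Let $\tilde U$ be obtained from $U$ by adding $m$ further symbols, and let $\tilde A\in\mathrm{Mat}_{(n+1)\times m}(\mathfrak O[X_{\tilde U}])$ be obtained from $A$ by adding a row whose entries are (in some order) the $m$ variables attached to the symbols in $\tilde U\setminus U$. Then $\mathsf Z^{\mathrm{ask}}_{\tilde A/\mathfrak O}(T)=\mathsf Z^{\mathrm{ask}}_{A/\mathfrak O}(T)\cdot\frac{1-q^{n-m}T}{1-q^{n-m+1}T}$.
   Context: A compact DVR $\mathfrak O$ has maximal ideal $\mathfrak P$ and finite residue field. $X_U=(X_u)_{u\in U}$ are independent variables; a matrix of linear forms has entries of the form $\sum_{u\in U}c_uX_u$ with $c_u\in\mathfrak O$. For $A\in\mathrm{Mat}_{n\times m}(\mathfrak O[X_U])$ of linear forms, $\mathsf Z^{\mathrm{ask}}_{A/\mathfrak O}(T)=\sum_{k\ge0}\alpha_kT^k$, where $\alpha_k$ is the average, over $x\in(\mathfrak O/\mathfrak P^k)U$, of $|\ker A(x)|$, with $A(x)$ viewed as the map $(\mathfrak O/\mathfrak P^k)^n\to(\mathfrak O/\mathfrak P^k)^m$ given by right multiplication on row vectors. *)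

(* Defs.v *)
From HB Require Import structures.
From mathcomp Require Import all_boot all_order all_algebra finmap.
From mathcomp Require Import generic_quotient ring_quotient.
From mathcomp Require Import all_classical topology.
From mathcomp Require Import monalg.

Set Implicit Arguments.
Unset Strict Implicit.
Unset Printing Implicit Defensive.

Import GRing.Theory.

Local Open Scope ring_scope.
Local Open Scope classical_set_scope.

(* Ideals are subsets in the sense of classical_sets, and need not be
   proper: the zeroth power of an ideal is the whole ring. *)
Record ideal (R : comNzRingType) := Ideal {
  ideal_set :> set R;
  ideal0 : ideal_set 0;
  idealD : forall x y, ideal_set x -> ideal_set y -> ideal_set (x + y);
  idealM : forall a x, ideal_set x -> ideal_set (a * x)
}.

Section IdealOps.
Variable R : comNzRingType.
Implicit Types I J : ideal R.

Definition ideal_top : ideal R :=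
  @Ideal R setT Logic.I (fun _ _ _ _ => Logic.I) (fun _ _ _ => Logic.I).

Definition ideal_mul_set I J : set R :=
  [set z | exists s : seq (R * R),
     (forall p, p \in s -> ideal_set I p.1 /\ ideal_set J p.2) /\ z = \sum_(p <- s) p.1 * p.2].

Fact ideal_mul0 I J : ideal_mul_set I J 0.
Proof. by exists [::]; split => [//|]; rewrite big_nil. Qed.

Fact ideal_mulD I J x y :
  ideal_mul_set I J x -> ideal_mul_set I J y -> ideal_mul_set I J (x + y).
Proof.
move=> [s [sIJ ->]] [t [tIJ ->]]; exists (s ++ t); split; last by rewrite big_cat.
by move=> p; rewrite mem_cat => /orP[/sIJ|/tIJ].
Qed.

Fact ideal_mulM I J a x : ideal_mul_set I J x -> ideal_mul_set I J (a * x).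
Proof.
move=> [s [sIJ ->]]; exists [seq (a * p.1, p.2) | p <- s]; split.
  by move=> _ /mapP[p /sIJ[Ip Jp] ->] /=; split=> //; exact: idealM.
by rewrite big_map big_distrr; apply: eq_bigr => p _; rewrite /= mulrA.
Qed.

Definition ideal_mul I J : ideal R :=
  Ideal (ideal_mul0 I J) (@ideal_mulD I J) (@ideal_mulM I J).

Definition ideal_pow I (k : nat) : ideal R := iter k (ideal_mul I) ideal_top.

Lemma idealN I x : ideal_set I x -> ideal_set I (- x).
Proof. by rewrite -mulN1r; exact: idealM. Qed.

End IdealOps.

(* mathcomp's {ideal_quot I} requires I to be proper, which excludes the
   zero ring R / R; hence the ring structure below, built on top of the
   library's quotient of a Z-module. *)
Section IdealQuotient.
Variables (R : comNzRingType) (I : ideal R).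

Definition ideal_pred : R -> bool := fun x => `[< ideal_set I x >].

Fact ideal_pred_zmod_closed : zmod_closed ideal_pred.
Proof.
split=> [|x y]; rewrite -!topredE /= /ideal_pred; first exact/asboolP/ideal0.
by move=> /asboolP Ix /asboolP Iy; apply/asboolP/idealD => //; exact: idealN.
Qed.

HB.instance Definition _ :=
  GRing.isZmodClosed.Build R ideal_pred ideal_pred_zmod_closed.

Definition ideal_zmod : zmodClosed R :=
  GRing.ZmodClosed.clone R ideal_pred _.

Definition quo : Type := {ideal_quot ideal_zmod}.

HB.instance Definition _ := Choice.on quo.
HB.instance Definition _ := GRing.Zmodule.on quo.

Definition quo_proj (x : R) : quo := (\pi_({ideal_quot ideal_zmod}) x)%qT.

Lemma quo_projP x y : (quo_proj x = quo_proj y) <-> ideal_set I (x - y).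
Proof.
have -> : ideal_set I (x - y) <-> (x - y) \in ideal_pred by split=> /asboolP.
by rewrite Quotient.idealrBE; split => /eqP.
Qed.

Lemma quo_proj_surj (u : quo) : exists x, u = quo_proj x.
Proof. by exists (repr u); rewrite /quo_proj reprK. Qed.

Lemma quo_projD : {morph quo_proj : x y / x + y}.
Proof. by move=> x y; exact: Quotient.pi_add. Qed.

Definition quo_one : quo := quo_proj 1.

Definition quo_mul (u v : quo) : quo := quo_proj (repr u * repr v).

Lemma quo_projM : {morph quo_proj : x y / x * y >-> quo_mul x y}.
Proof.
have reprP x : ideal_set I (x - repr (quo_proj x)) by apply/quo_projP; rewrite /quo_proj reprK.
move=> x y; apply/quo_projP.
set x' := repr _; set y' := repr _.
have -> : x * y - x' * y' = y * (x - x') + x' * (y - y').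
  by rewrite !mulrBr [y * x]mulrC [y * x']mulrC addrA subrK.
by apply: idealD; apply: idealM; exact: reprP.
Qed.

Fact quo_mulA : associative quo_mul.
Proof.
move=> u v w; have [[x ->] [[y ->] [z ->]]] :=
  (quo_proj_surj u, (quo_proj_surj v, quo_proj_surj w)).
by rewrite -!quo_projM mulrA.
Qed.

Fact quo_mulC : commutative quo_mul.
Proof. by move=> u v; rewrite /quo_mul mulrC. Qed.

Fact quo_mul1 : left_id quo_one quo_mul.
Proof. by move=> u; have [x ->] := quo_proj_surj u; rewrite -quo_projM mul1r. Qed.

Fact quo_mulDl : left_distributive quo_mul +%R.
Proof.
move=> u v w; have [[x ->] [[y ->] [z ->]]] :=
  (quo_proj_surj u, (quo_proj_surj v, quo_proj_surj w)).
by rewrite -quo_projD -!quo_projM -quo_projD mulrDl.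
Qed.

HB.instance Definition _ := GRing.Zmodule_isComPzRing.Build quo
  quo_mulA quo_mulC quo_mul1 quo_mulDl.

End IdealQuotient.

(* A copy of R carrying the I-adic topology. *)
Definition adic (R : comNzRingType) (I : ideal R) : Type := R.

Section AdicTopology.
Variables (R : comNzRingType) (I : ideal R).

HB.instance Definition _ := GRing.ComNzRing.on (adic I).
HB.instance Definition _ := isPointed.Build (adic I) 0.

Definition adic_nbhs (x : adic I) : set_system (adic I) :=
  [set A | exists k : nat, [set y | ideal_set (ideal_pow I k) (y - x : R)] `<=` A].

HB.instance Definition _ := hasNbhs.Build (adic I) adic_nbhs.

Lemma ideal_powS k x : ideal_set (ideal_pow I k.+1) x -> ideal_set (ideal_pow I k) x.
Proof.
move=> [s [+ ->]]; elim: s => [_|p s IHs sI]; first by rewrite big_nil; exact: ideal0.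
rewrite big_cons; apply: idealD.
  by apply: idealM; have [] := sI p (mem_head _ _).
by apply: IHs => q qs; apply: sI; rewrite in_cons qs orbT.
Qed.

Lemma ideal_pow_le k l x : (k <= l)%N ->
  ideal_set (ideal_pow I l) x -> ideal_set (ideal_pow I k) x.
Proof.
by move=> /subnK <-; elim: (l - k)%N => [//|j IHj] /ideal_powS.
Qed.

Fact adic_nbhs_filter (x : adic I) : ProperFilter (nbhs x).
Proof.
split.
  move=> [k /(_ x)]; apply; rewrite /mkset.
  by have -> : (x - x : R) = 0 by [exact: subrr]; exact: ideal0.
split; first by exists 0%N.
  move=> A B [k kA] [l lB]; exists (maxn k l) => y xy; split.
    by apply: kA; apply: ideal_pow_le xy; exact: leq_maxl.
  by apply: lB; apply: ideal_pow_le xy; exact: leq_maxr.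
by move=> A B AB [k kA]; exists k; exact: subset_trans AB.
Qed.

Fact adic_nbhs_singleton (x : adic I) (A : set (adic I)) : nbhs x A -> A x.
Proof.
move=> [k]; apply; rewrite /mkset.
by have -> : (x - x : R) = 0 by [exact: subrr]; exact: ideal0.
Qed.

Fact adic_nbhs_nbhs (x : adic I) (A : set (adic I)) :
  nbhs x A -> nbhs x (nbhs^~ A).
Proof.
move=> [k kA]; exists k => y xy; exists k => z yz; apply: kA; rewrite /mkset.
have -> : (z - x : R) = (z - y : R) + (y - x : R) by rewrite [RHS]subrKA.
exact: idealD.
Qed.

HB.instance Definition _ := Nbhs_isNbhsTopological.Build (adic I)
  adic_nbhs_filter adic_nbhs_singleton adic_nbhs_nbhs.

End AdicTopology.

Definition principal_ideal_domain (R : idomainType) : Prop :=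
  forall I : ideal R, exists a : R, I = range (fun b => b * a) :> set R.

Definition maximal_ideal (R : comNzRingType) (I : ideal R) : Prop :=
  ~ ideal_set I 1 /\ forall J : ideal R, I `<=` J -> ~ ideal_set J 1 -> J = I :> set R.

(* P is the maximal ideal of the discrete valuation ring R, i.e. of a
   local principal ideal domain that is not a field. *)
Definition discrete_valuation_ring (R : idomainType) (P : ideal R) : Prop :=
  [/\ principal_ideal_domain R,
      maximal_ideal P,
      forall Q : ideal R, maximal_ideal Q -> Q = P :> set R
    & P <> [set 0] :> set R].

Definition compact_dvr (R : idomainType) (P : ideal R) : Prop :=
  discrete_valuation_ring P /\ compact [set: adic P].

(* The polynomial ring R[X_U] is {malg R[{cmonom U}]}. *)
Definition mvar (R : comNzRingType) (U : finType) (u : U) :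
  {malg R[{cmonom U}]} := mkmalgU (ucm u) 1.

Definition linear_form (R : comNzRingType) (U : finType)
    (f : {malg R[{cmonom U}]}) : Prop :=
  exists c : U -> R, f = \sum_(u : U) c u *: mvar R u.

(* Same formula as mmap in monalg, which does not allow S to be the zero
   ring. *)
Definition mpeval (R : comNzRingType) (U : finType) (S : comPzRingType)
    (h : R -> S) (x : U -> S) (f : {malg R[{cmonom U}]}) : S :=
  \sum_(m <- msupp f) h (mcoeff m f) * \prod_(u : U) x u ^+ m u.

Definition mprename (R : comNzRingType) (U V : finType) (i : U -> V) :
    {malg R[{cmonom U}]} -> {malg R[{cmonom V}]} :=
  mpeval (S := {malg R[{cmonom V}]}) (fun c : R => c%:MP) (fun u => mvar R (i u)).

Record fps (R : Type) := FPS { fps_coef : nat -> R }.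

HB.instance Definition _ (R : Type) := gen_eqMixin (fps R).
HB.instance Definition _ (R : Type) := gen_choiceMixin (fps R).

Section FpsRing.
Variable K : fieldType.
Implicit Types (f g h : fps K) (p : {poly K}).
Local Notation "f `[ i ]" := (fps_coef f i) (at level 2, format "f `[ i ]").

Definition fps_of_poly p : fps K := FPS (fun i => p`_i).
Definition fps_add f g : fps K := FPS (fun i => f`[i] + g`[i]).
Definition fps_opp f : fps K := FPS (fun i => - f`[i]).
Definition fps_mul f g : fps K :=
  FPS (fun i => \sum_(j < i.+1) f`[j] * g`[i - j]).

Lemma fpsP f g : (forall i, f`[i] = g`[i]) -> f = g.
Proof. by case: f g => f [g] /= fg; congr FPS; apply: funext. Qed.

Fact fps_addA : associative fps_add.
Proof. by move=> f g h; apply: fpsP => i /=; rewrite addrA. Qed.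
Fact fps_addC : commutative fps_add.
Proof. by move=> f g; apply: fpsP => i /=; rewrite addrC. Qed.
Fact fps_add0 : left_id (fps_of_poly 0) fps_add.
Proof. by move=> f; apply: fpsP => i /=; rewrite coef0 add0r. Qed.
Fact fps_addN : left_inverse (fps_of_poly 0) fps_opp fps_add.
Proof. by move=> f; apply: fpsP => i /=; rewrite coef0 addNr. Qed.

HB.instance Definition _ :=
  GRing.isZmodule.Build (fps K) fps_addA fps_addC fps_add0 fps_addN.

Definition fps_trunc (n : nat) f : {poly K} := \poly_(i < n) f`[i].

Lemma fps_mul_trunc n f g i : (i < n)%N ->
  (fps_mul f g)`[i] = (fps_trunc n f * fps_trunc n g)`_i.
Proof.
move=> ltin; rewrite coefM /=; apply: eq_bigr => j _.
rewrite !coef_poly (leq_ltn_trans (leq_subr _ _) ltin).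
by rewrite (leq_ltn_trans _ ltin) // -ltnS.
Qed.

Fact fps_mulA : associative fps_mul.
Proof.
move=> f g h; apply: fpsP => i.
have truncM a b j : (j < i.+1)%N ->
    (fps_trunc i.+1 (fps_mul a b))`_j = (fps_trunc i.+1 a * fps_trunc i.+1 b)`_j.
  by move=> ltji; rewrite coef_poly ltji; exact: fps_mul_trunc.
rewrite !(@fps_mul_trunc i.+1) //.
transitivity ((fps_trunc i.+1 f * (fps_trunc i.+1 g * fps_trunc i.+1 h))`_i).
  by rewrite !coefM; apply: eq_bigr => j _; rewrite truncM // ltnS leq_subr.
by rewrite mulrA !coefM; apply: eq_bigr => j _; rewrite truncM.
Qed.

Fact fps_mulC : commutative fps_mul.
Proof.
by move=> f g; apply: fpsP => i; rewrite !(@fps_mul_trunc i.+1) // mulrC.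
Qed.

Fact fps_mul1 : left_id (fps_of_poly 1) fps_mul.
Proof.
move=> f; apply: fpsP => i /=; rewrite big_ord_recl coef1 mul1r subn0.
by rewrite big1 ?addr0 // => j _; rewrite coef1 mul0r.
Qed.

Fact fps_mulDl : left_distributive fps_mul fps_add.
Proof.
move=> f g h; apply: fpsP => i /=; rewrite -big_split.
by apply: eq_bigr => j _; rewrite mulrDl.
Qed.

Fact fps_oner_neq0 : fps_of_poly 1 != 0.
Proof.
by apply/eqP => -[/(congr1 (@^~ 0%N))] /eqP; rewrite coef1 coef0 oner_eq0.
Qed.

HB.instance Definition _ := GRing.Zmodule_isComNzRing.Build (fps K)
  fps_mulA fps_mulC fps_mul1 fps_mulDl fps_oner_neq0.

Definition fps_unit : {pred fps K} := fun f => f`[0] != 0.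

(* The first n coefficients of the inverse of f, when f`[0] != 0. *)
Fixpoint fps_inv_seq f (n : nat) : seq K :=
  if n is n'.+1 then
    let s := fps_inv_seq f n' in
    rcons s (f`[0]^-1 * ((n' == 0)%:R - \sum_(j < n') s`_j * f`[n' - j]))
  else [::].

Definition fps_inv f : fps K :=
  if f \in fps_unit then FPS (fun i => (fps_inv_seq f i.+1)`_i) else f.

Lemma size_fps_inv_seq f n : size (fps_inv_seq f n) = n.
Proof. by elim: n => //= n IHn; rewrite size_rcons IHn. Qed.

Lemma nth_fps_inv_seq f n i : (i < n)%N ->
  (fps_inv_seq f n)`_i = (fps_inv_seq f i.+1)`_i.
Proof.
elim: n => // n IHn; rewrite ltnS leq_eqVlt => /predU1P[-> //|ltin].
by rewrite [LHS]nth_rcons size_fps_inv_seq ltin IHn.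
Qed.

Fact fps_mulVf : {in fps_unit, left_inverse 1 fps_inv *%R}.
Proof.
move=> f fU; apply: fpsP => i; rewrite /fps_inv fU.
change (\sum_(j < i.+1) (fps_inv_seq f j.+1)`_j * f`[i - j] = (1 : {poly K})`_i).
have invE : \sum_(j < i) (fps_inv_seq f i)`_j * f`[i - j] =
    \sum_(j < i) (fps_inv_seq f j.+1)`_j * f`[i - j].
  by apply: eq_bigr => j _; rewrite nth_fps_inv_seq.
rewrite big_ord_recr /= -invE subnn nth_rcons size_fps_inv_seq ltnn eqxx.
by rewrite mulrAC mulVf // mul1r coef1 addrC subrK.
Qed.

Fact fps_unitP f g : g * f = 1 -> f \in fps_unit.
Proof.
move=> [/(congr1 (@^~ 0%N))] /=; rewrite big_ord_recl big_ord0 addr0 coef1 /=.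
move=> gf; apply/eqP => f0; have /eqP := gf.
by rewrite subn0 f0 mulr0 eq_sym oner_eq0.
Qed.

Fact fps_inv_out : {in [predC fps_unit], fps_inv =1 id}.
Proof. by move=> f; rewrite inE /fps_inv => /negbTE ->. Qed.

HB.instance Definition _ := GRing.ComNzRing_hasMulInverse.Build (fps K)
  fps_mulVf fps_unitP fps_inv_out.

End FpsRing.

Section Ask.
Variables (R : idomainType) (P : ideal R) (U : finType) (n m : nat).
Variable A : 'M[{malg R[{cmonom U}]}]_(n, m).

Definition spec_mx (k : nat) (x : {ffun U -> quo (ideal_pow P k)}) :
    'M[quo (ideal_pow P k)]_(n, m) :=
  map_mx (mpeval (@quo_proj R (ideal_pow P k)) x) A.

Definition spec_ker (k : nat) (x : {ffun U -> quo (ideal_pow P k)}) :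
    set 'rV[quo (ideal_pow P k)]_n :=
  [set v | v *m spec_mx x = 0].

(* All the sets involved are finite when P is the maximal ideal of a
   compact discrete valuation ring. *)
Definition ask (k : nat) : rat :=
  (\sum_(x \in [set: {ffun U -> quo (ideal_pow P k)}])
      (#|` fset_set (spec_ker x)|%:R : rat))
  / #|` fset_set [set: {ffun U -> quo (ideal_pow P k)}]|%:R.

Definition Zask : fps rat := FPS ask.

End Ask.

(* Main.v *)
(* Write Q_k for O / P^k.  A point of the extended system at level k is a pair
   (x, y), with y the added row, and a kernel vector is a pair (t, v) with
   t y + v A(x) = 0.  If t has valuation i in Q_k, then t Q_k is the kernel of
   Q_k -> Q_i; hence this equation is solvable in y exactly when v A(x) vanishes
   in Q_i, and it then has q^(i m) solutions.  Counting the triples (x, v, y)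
   first for fixed t, and using that Q_k contains q^(k-i) - q^(k-i-1) elements
   of valuation i < k and one of valuation k, expresses the coefficients of the
   extended series as the convolution
     a~_k = sum_(l <= k) N_l r^l a_(k-l),   r = q^(n-m), N_0 = 1,
     N_l = q^l - q^(l-1) for l > 0,
   and sum_l N_l (r T)^l = (1 - r T) / (1 - r q T). *)

Require Import Defs.
From HB Require Import structures.
From mathcomp Require Import all_boot all_order all_algebra finmap.
From mathcomp Require Import all_classical topology.
From mathcomp Require Import monalg.
From mathcomp Require Import ring.

Set Implicit Arguments.
Unset Strict Implicit.
Unset Printing Implicit Defensive.

Import GRing.Theory.

Local Open Scope ring_scope.
Local Open Scope classical_set_scope.

(** * Evaluation of linear forms *)

Lemma ucm_inj (V : finType) : injective (@ucm V).
Proof.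
move=> u v uv; apply/eqP; have := congr1 (fun w : {cmonom V} => w v) uv.
by rewrite /= !ucmE eqxx; case: eqP.
Qed.

Section LinearForms.
Variables (R : comNzRingType) (U V : finType) (f : U -> V) (c : U -> R).
Hypothesis f_inj : injective f.

Let lform : {malg R[{cmonom V}]} := \sum_u c u *: mvar R (f u).

Lemma mcoeff_lform m : mcoeff m lform = \sum_u c u * (ucm (f u) == m)%:R.
Proof.
rewrite /lform raddf_sum; apply: eq_bigr => u _.
by rewrite /= mcoeffZ /mvar mcoeffU1.
Qed.

(** [mpeval] sums over the support only, from which zero coefficients are absent. The sum is
    enlarged to all monomials [ucm (f u)]: as [h 0 = 0] nothing is added, and injectivity of [f]
    keeps these monomials distinct. *)
Lemma mpeval_lform (S : comPzRingType) (h : R -> S) (x : V -> S) :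
  h 0 = 0 -> mpeval h x lform = \sum_u h (c u) * x (f u).
Proof.
move=> h0; pose E := [fset ucm (f u) | u in U]%fset.
have supp : {subset msupp lform <= E}.
  move=> m; rewrite -mcoeff_neq0 mcoeff_lform; apply: contraNT => mE.
  rewrite big1 // => u _; case: eqP => [mu|_]; last by rewrite mulr0.
  by case/negP: mE; rewrite -mu; apply/imfsetP; exists u.
rewrite /mpeval (big_fset_incl _ (B := E)) /=; first last.
- by move=> m _; rewrite -mcoeff_eq0 => /eqP ->; rewrite h0 mul0r.
- exact/fsubsetP.
rewrite big_imfset /=; last by move=> u v _ _ /ucm_inj /f_inj.
rewrite big_enum; apply: eq_bigr => u _; congr (h _ * _).
  rewrite mcoeff_lform (bigD1 u) //= eqxx mulr1 big1 ?addr0 // => v vu.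
  by rewrite (inj_eq (@ucm_inj _)) (inj_eq f_inj) (negbTE vu) mulr0.
rewrite (bigD1 (f u)) //= ucmE eqxx expr1 big1 ?mulr1 // => v vu.
by rewrite ucmE eq_sym (negbTE vu).
Qed.

End LinearForms.

Lemma mpeval_mvar (R : comNzRingType) (V : finType) (v : V)
    (S : comPzRingType) (h : R -> S) (x : V -> S) :
  h 0 = 0 -> h 1 = 1 -> mpeval h x (mvar R v) = x v.
Proof.
move=> h0 h1; have := mpeval_lform (f := fun _ : unit => v) (fun _ : unit => 1) _ x h0.
by rewrite !big_const card_unit /= !addr0 scale1r h1 mul1r; apply=> -[] [].
Qed.

Lemma mprename_lform (R : comNzRingType) (U V : finType) (f : U -> V) (c : U -> R) :
  mprename f (\sum_u c u *: mvar R u) = \sum_u c u *: mvar R (f u).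
Proof.
rewrite /mprename mpeval_lform ?malgC0E //.
by apply: eq_bigr => u _; rewrite mul_malgC.
Qed.

(** * Finite sets and finite quotient rings *)

Lemma fset_set_finE (T : finType) (A : set T) :
  #|` fset_set A| = #|[pred x | `[< A x >]]|.
Proof.
rewrite cardE; apply: perm_size; apply: uniq_perm; rewrite ?fset_uniq ?enum_uniq //.
move=> x; rewrite in_fset_set; last exact: finite_finset.
by rewrite mem_enum; apply/idP/idP => /asboolP h; apply/asboolP.
Qed.

Lemma fsbig_finE (T : finType) (F : T -> rat) :
  \sum_(x \in [set: T]) F x = \sum_x F x.
Proof.
rewrite fsbig_finite; last exact: finite_finset.
apply: perm_big; apply: uniq_perm; rewrite ?fset_uniq ?index_enum_uniq //.
move=> x; rewrite in_fset_set; last exact: finite_finset.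
by rewrite mem_index_enum; exact/asboolP.
Qed.

(* A finiteness proof carried by the type lets canonical structures find the
   finite ring structure on the quotient. *)
Definition fquo (R : comNzRingType) (I : ideal R) of finite_set [set: quo I] : Type := quo I.

Section FiniteQuotient.
Variables (R : comNzRingType) (I : ideal R) (fin : finite_set [set: quo I]).
Local Notation Q := (fquo fin).

HB.instance Definition _ := Choice.on Q.
HB.instance Definition _ := GRing.ComPzRing.on Q.

Let elems : seq Q := fset_set [set: quo I].

Let mem_elems (x : Q) : x \in elems.
Proof. by rewrite /elems in_fset_set // inE. Qed.

Fact fquo_pickleK : pcancel (index^~ elems) (nth None (map Some elems)).
Proof.
move=> x; rewrite (nth_map (0 : Q)) ?index_mem ?mem_elems //.
by rewrite nth_index ?mem_elems.
Qed.

HB.instance Definition _ := Choice_isCountable.Build Q fquo_pickleK.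

Fact fquo_enumP : Finite.axiom elems.
Proof. by move=> x; rewrite count_uniq_mem ?mem_elems // fset_uniq. Qed.

HB.instance Definition _ := isFinite.Build Q fquo_enumP.

Definition fproj (x : R) : Q := quo_proj I x.

Lemma fprojD : {morph fproj : x y / x + y}. Proof. exact: quo_projD. Qed.
Lemma fprojM : {morph fproj : x y / x * y}. Proof. exact: quo_projM. Qed.
Lemma fprojP x y : fproj x = fproj y <-> ideal_set I (x - y). Proof. exact: quo_projP. Qed.
Lemma fproj_surj u : exists x, u = fproj x. Proof. exact: quo_proj_surj. Qed.
Lemma fproj1 : fproj 1 = 1. Proof. by []. Qed.

Lemma fproj0 : fproj 0 = 0.
Proof. by apply: (addIr (fproj 0)); rewrite -fprojD !add0r. Qed.

Lemma fproj_eq0 x : fproj x = 0 <-> ideal_set I x.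
Proof. by rewrite -fproj0 fprojP subr0. Qed.

End FiniteQuotient.

(** * Reduction between quotients of one ring *)

Section QuotientReduction.
Variables (R : comNzRingType) (I J : ideal R).
Variables (finI : finite_set [set: quo I]) (finJ : finite_set [set: quo J]).

(** Passing through a representative needs no relation between [I] and [J], so terms such as
    [red (fin i) t] carry no proof of [i <= k]. For [I] inside [J] the choice does not matter
    ([red_fproj]). *)
Definition red (u : fquo finI) : fquo finJ := fproj finJ (repr (u : quo I)).

(* The inclusion is an argument here so that the ring morphism structure on
   the reduction map can be inferred. *)
Definition red_morphism of (forall x, ideal_set I x -> ideal_set J x) := red.

Hypothesis IJ : forall x, ideal_set I x -> ideal_set J x.

Lemma red_fproj x : red (fproj finI x) = fproj finJ x.
Proof.
by apply/fprojP/IJ; rewrite -(fprojP finI) /fproj /quo_proj reprK.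
Qed.

Fact red_is_zmod_morphism : zmod_morphism (red_morphism IJ).
Proof.
move=> u v; have [x ->] := fproj_surj u; have [y ->] := fproj_surj v.
have fprojB K (finK : finite_set [set: quo K]) : fproj finK (x - y) = fproj finK x - fproj finK y.
  by apply/eqP; rewrite eq_sym subr_eq -fprojD subrK.
by rewrite /red_morphism -fprojB !red_fproj fprojB.
Qed.

Fact red_is_monoid_morphism : monoid_morphism (red_morphism IJ).
Proof.
split; first by rewrite -(fproj1 finI) /red_morphism red_fproj.
move=> u v; have [x ->] := fproj_surj u; have [y ->] := fproj_surj v.
by rewrite /red_morphism -fprojM !red_fproj fprojM.
Qed.

HB.instance Definition _ := GRing.isZmodMorphism.Build
  (fquo finI) (fquo finJ) (red_morphism IJ) red_is_zmod_morphism.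
HB.instance Definition _ := GRing.isMonoidMorphism.Build
  (fquo finI) (fquo finJ) (red_morphism IJ) red_is_monoid_morphism.

Lemma red_surj v : exists u, red u = v.
Proof. by have [x ->] := fproj_surj v; exists (fproj finI x); exact: red_fproj. Qed.

End QuotientReduction.

Lemma card_fquo (R : comNzRingType) (I : ideal R) (fin : finite_set [set: quo I]) (c : nat) :
  ([set: quo I] #= `I_c)%card <-> #|{: fquo fin}| = c.
Proof.
have <- : #|` fset_set [set: quo I]| = #|{: fquo fin}|.
  rewrite (fset_set_finE (T := fquo fin)).
  by apply: eq_card => x; rewrite !inE; apply/asboolP.
split=> [/card_fset_set //|Ic].
by rewrite -(fset_setK fin); apply/card_eq_fsetP.
Qed.

(** * Powers of a principal maximal ideal *)

Section PrimePowers.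
Variables (R : idomainType) (P : ideal R) (pi : R).
Hypothesis P_pi : P = range (fun b => b * pi) :> set R.

(** A finite sum of products (c pi)(d pi^k) is again a single multiple of pi^(k+1). *)
Lemma ideal_powP k x : ideal_set (ideal_pow P k) x <-> exists b, x = b * pi ^+ k.
Proof.
have PP y : ideal_set P y <-> exists b, y = b * pi.
  by rewrite P_pi; split=> [[b _ <-]|[b ->]]; exists b.
elim: k x => [|k IHk] x; first by split=> // _; exists x; rewrite expr0 mulr1.
split=> [[s [sP ->]]|[b ->]]; last first.
  exists [:: (pi, b * pi ^+ k)]; split; last by rewrite big_seq1 /= mulrCA exprS.
  move=> p; rewrite inE => /eqP -> /=; split; first by apply/PP; exists 1; rewrite mul1r.
  by apply/IHk; exists b.
elim: s sP => [|p s IHs] sP; first by exists 0; rewrite big_nil mul0r.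
have [|b bE] := IHs; first by move=> p' p's; apply: sP; rewrite inE p's orbT.
have [/PP[c cE] /IHk[d dE]] := sP p (mem_head _ _).
by exists (c * d + b); rewrite big_cons bE cE dE mulrDl exprS; congr (_ + _); rewrite mulrACA.
Qed.

Hypothesis P_max : maximal_ideal P.

(** The ideal [J0] is P + u R. It contains P and [u], so by maximality it contains 1. *)
Lemma maximal_inverse u : ~ ideal_set P u -> exists v, ideal_set P (1 - u * v).
Proof.
move=> Pu; have [_ maxP] := P_max.
pose J0 : set R := [set x | exists b, ideal_set P (x - u * b)].
have J00 : J0 0 by exists 0; rewrite mulr0 subr0; exact: ideal0.
have J0D x y : J0 x -> J0 y -> J0 (x + y).
  move=> [b Pb] [c Pc]; exists (b + c).
  by rewrite mulrDr opprD addrACA; exact: idealD.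
have J0M a x : J0 x -> J0 (a * x).
  by move=> [b Pb]; exists (a * b); rewrite mulrCA -mulrBr; exact: idealM.
have [[v Pv]|J1] := pselect (J0 1); first by exists v.
case: Pu; have <- := maxP (Ideal J00 J0D J0M) _ J1.
  by exists 1; rewrite mulr1 subrr; exact: ideal0.
by move=> x Px; exists 0; rewrite mulr0 subr0.
Qed.

Hypothesis pi_neq0 : pi != 0.
Variable q : nat.
Hypothesis card_residue : ([set: quo P] #= `I_q)%card.

(** Induction on k: the digit map (a, b) -> a + b pi^k, formed on representatives, is a bijection of
    sets from Q_k x R/P onto Q_(k+1). *)
Lemma card_quo_pow k : ([set: quo (ideal_pow P k)] #= `I_(q ^ k))%card.
Proof.
have finP : finite_set [set: quo P] by apply/finite_setP; exists q.
elim: k => [|k IHk].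
  (* P^0 is the whole ring, so this quotient is the zero ring, with q^0 = 1 element. *)
  have zero (u : quo (ideal_pow P 0)) : u = quo_proj _ 0.
    by have [x ->] := quo_proj_surj u; apply/quo_projP.
  have fin0 : finite_set [set: quo (ideal_pow P 0)].
    by apply: (sub_finite_set (B := [set quo_proj _ 0])) => [u _|];
      [exact: zero|exact: finite_set1].
  apply/(card_fquo fin0); rewrite expn0; apply/eqP/fintype1P.
  by exists (quo_proj _ 0) => u; exact: zero.
have fink : finite_set [set: quo (ideal_pow P k)] by apply/finite_setP; exists (q ^ k)%N.
pose f (p : fquo fink * fquo finP) : quo (ideal_pow P k.+1) :=
  quo_proj _ (repr (p.1 : quo _) + repr (p.2 : quo _) * pi ^+ k).
have f_surj z : exists p, f p = z.
  have [x ->] := quo_proj_surj z.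
  have reprP (I : ideal R) y : ideal_set I (y - repr (quo_proj I y)).
    by apply/quo_projP; rewrite /quo_proj reprK.
  have /ideal_powP[b bE] := reprP (ideal_pow P k) x.
  exists (quo_proj _ x, quo_proj _ b); apply/esym/quo_projP => /=.
  rewrite opprD addrA bE -mulrBl; apply/(ideal_powP k.+1).
  have := reprP P b; rewrite P_pi => -[c _ cE]; exists c.
  by rewrite -cE exprS mulrA.
have f_inj : injective f.
  move=> [a b] [a' b'] /quo_projP /= /(ideal_powP k.+1)[c cE].
  have aa' : a = a'.
    rewrite -[a]reprK -[a']reprK; apply/quo_projP/ideal_powP.
    (* The witness solves a + b pi^k - a' - b' pi^k = c pi^(k+1) for a - a'. *)
    exists (c * pi - (repr (b : quo _) - repr (b' : quo _))).
    rewrite mulrBl -mulrA -exprS -cE mulrBl; ring.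
  congr (_, _) => //; rewrite -[b]reprK -[b']reprK; apply/quo_projP.
  rewrite P_pi; exists c => //; apply: (mulIf (expf_neq0 k pi_neq0)).
  by rewrite -mulrA -exprS -cE aa' mulrBl; ring.
have finS : finite_set [set: quo (ideal_pow P k.+1)].
  have -> : [set: quo (ideal_pow P k.+1)] = range f.
    by apply/seteqP; split=> // z _; have [p <-] := f_surj z; exists p.
  exact/finite_image/finite_finset.
apply/(card_fquo finS); rewrite expnSr.
have <- : #|{: fquo fink}| = (q ^ k)%N by apply/card_fquo.
have <- : #|{: fquo finP}| = q by apply/card_fquo.
rewrite -card_prod; apply/esym/(bij_eq_card (f := f : _ -> fquo finS)).
have [g fK] := choice f_surj; exists g => // p; exact: f_inj.
Qed.

End PrimePowers.

(** * Counting along fibres *)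

Lemma card_sum_bool (T : finType) (p : pred T) : #|p| = (\sum_x p x)%N.
Proof. by rewrite -sum1_card big_mkcond; apply: eq_bigr => x _; rewrite unfold_in; case: (p x). Qed.

(** Both sides equal c |T'| times the sum of [g]; this form avoids division. *)
Lemma sum_comp_fiber (T T' : finType) (f : T -> T') (c : nat) (g : T' -> nat) :
  (forall y, #|[pred x | f x == y]| = c) ->
  (#|T'| * \sum_x g (f x) = #|T| * \sum_y g y)%N.
Proof.
move=> fc.
have sumf (h : T' -> nat) : (\sum_x h (f x) = c * \sum_y h y)%N.
  rewrite (partition_big f xpredT) //= big_distrr; apply: eq_bigr => y _ /=.
  rewrite (eq_bigr (fun=> h y)) => [|x /eqP -> //].
  by rewrite sum_nat_const fc.
have -> : #|T| = (c * #|T'|)%N by have := sumf (fun=> 1%N); rewrite !sum1_card.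
by rewrite sumf mulnCA mulnA.
Qed.

Lemma card_ffun_forall (U F : finType) (p : U -> pred F) :
  #|[pred x : {ffun U -> F} | [forall u, p u (x u)]]| = (\prod_u #|p u|)%N.
Proof.
have := card_family p; rewrite foldrE big_map enumT => <-.
by apply: eq_card => x; rewrite !inE.
Qed.

(** The nonempty fibres of an additive map are translates of its kernel, hence equinumerous, and
    they partition [F]. *)
Lemma card_fiber_codom (F G : finZmodType) (f : F -> G) (y : G) :
  {morph f : x y / x - y} -> y \in codom f -> (#|[pred x | f x == y]| * #|codom f| = #|F|)%N.
Proof.
move=> fB ycod; pose c := #|[pred x | f x == 0]|.
have fc z : z \in codom f -> #|[pred x | f x == z]| = c.
  move=> /codomP[x0 ->]; rewrite /c -!sum1_card (reindex (fun x => x + x0)) /=; last first.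
    exact/onW_bij/(Bijective (addrK x0) (subrK x0)).
  apply: eq_bigl => x; rewrite !inE.
  have f0 : f 0 = 0 by rewrite -[in LHS](subrr 0) fB subrr.
  have -> : x + x0 = x - (0 - x0) by rewrite sub0r opprK.
  by rewrite !fB f0 sub0r opprK -[X in _ == X]add0r (inj_eq (addIr _)).
rewrite fc // -[RHS]sum1_card (partition_big f [in codom f]) /=; last by move=> x _; exact: codom_f.
rewrite (eq_bigr (fun=> c)) => [|z zcod]; last by rewrite sum1_card fc.
by rewrite sum_nat_const mulnC.
Qed.

(** * Kernels of matrix pencils under reduction of the base ring *)

Definition pencil (F : comPzRingType) (U : finType) (n m : nat)
    (C : 'I_n -> 'I_m -> U -> F) (x : {ffun U -> F}) : 'M[F]_(n, m) :=
  \matrix_(i, j) \sum_u C i j u * x u.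

(** For F = Q_k, this is the numerator of the average that defines [ask] ([ask_total_ker]). *)
Definition total_ker (F : finComPzRingType) (U : finType) (n m : nat)
    (C : 'I_n -> 'I_m -> U -> F) : nat :=
  \sum_(x : {ffun U -> F}) #|[pred v : 'rV[F]_n | (v *m pencil C x == 0)%R]|.

Section FiberCounting.
Variables (F G : finComPzRingType) (rho : {rmorphism F -> G}).
Hypothesis rho_surj : forall b, exists a, rho a = b.

Lemma card_fiber_rmorphism (b : G) : (#|[pred a | rho a == b]| * #|G| = #|F|)%N.
Proof.
have cod z : z \in codom rho by apply/codomP; have [a <-] := rho_surj z; exists a.
rewrite -(card_fiber_codom (f := rho) (y := b)) //; last exact: rmorphB.
by congr muln; apply: eq_card => z; rewrite cod.
Qed.

(** The fibre over [y] is a product over [U] of fibres of [rho], each as large as the kernel of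
    [rho]. *)
Lemma sum_comp_ffun (U : finType) (g : {ffun U -> G} -> nat) :
  (#|G| ^ #|U| * \sum_(x : {ffun U -> F}) g [ffun u => rho (x u)] =
   #|F| ^ #|U| * \sum_x g x)%N.
Proof.
rewrite -!card_ffun.
pose f (x : {ffun U -> F}) : {ffun U -> G} := [ffun u => rho (x u)].
apply: (sum_comp_fiber (f := f) (c := (\prod_(u : U) #|[pred a | rho a == 0%R]|)%N)) => y.
have -> : #|[pred x | f x == y]| =
    #|[pred x : {ffun U -> F} | [forall u, [pred a | rho a == y u] (x u)]]|.
  apply: eq_card => x; rewrite !inE; apply/eqP/forallP => [<- u|xy].
    by rewrite /= ffunE.
  by apply/ffunP => u; rewrite ffunE; apply/eqP/xy.
rewrite (card_ffun_forall (fun u => [pred a | rho a == y u])); apply: eq_bigr => u _; apply/eqP.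
have G_gt0 : (0 < #|G|)%N by apply/card_gt0P; exists 0.
by rewrite -(eqn_pmul2r G_gt0) !card_fiber_rmorphism.
Qed.

Lemma sum_comp_rV (n : nat) (g : 'rV[G]_n -> nat) :
  (#|G| ^ n * \sum_(v : 'rV[F]_n) g (map_mx rho v) = #|F| ^ n * \sum_v g v)%N.
Proof.
have -> H : (#|(H : finType)| ^ n)%N = #|{: 'rV[H]_n}| by rewrite card_mx mul1n.
have -> : (#|F| ^ n)%N = #|{: 'rV[F]_n}| by rewrite card_mx mul1n.
apply: (sum_comp_fiber (f := @map_mx _ _ rho 1 n)
  (c := #|[pred v : 'rV[F]_n | map_mx rho v == 0%R]|)) => y.
have cod z : z \in codom (@map_mx _ _ rho 1 n).
  have [a az] := choice (fun j => rho_surj (z 0 j)).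
  by apply/codomP; exists (\row_j a j); apply/rowP => j; rewrite !mxE az.
have fB : {morph @map_mx _ _ rho 1 n : x y / x - y} by exact: map_mxB.
have cod_gt0 : (0 < #|codom (@map_mx _ _ rho 1 n)|)%N.
  by apply/card_gt0P; exists 0; exact: cod.
by apply/eqP; rewrite -(eqn_pmul2r cod_gt0) !card_fiber_codom.
Qed.

Variable t : F.
Hypothesis ker_rho : forall a, rho a = 0 <-> exists b, a = t * b.

(** Solutions exist exactly when -b lies in the image t F, which is the kernel of [rho]. They then
    form a translate of the annihilator of [t], of size |F| / |t F| = |F| / |ker rho| = |G|. *)
Lemma card_affine_eq (b : F) :
  #|[pred a | t * a + b == 0]| = (#|G| * (rho b == 0)%R)%N.
Proof.
have tB : {morph *%R t : x y / x - y} by exact: mulrBr.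
have -> : #|[pred a | t * a + b == 0]| = #|[pred a | t * a == - b]|.
  by apply: eq_card => a; rewrite !inE addr_eq0.
have [rb0|rb0] := eqVneq; last first.
  rewrite muln0; apply: eq_card0 => a; rewrite !inE; apply: contraNF rb0 => /eqP ta.
  by rewrite -[b]opprK -ta rmorphN oppr_eq0; apply/eqP/ker_rho; exists a.
rewrite muln1.
have cod0 : 0 \in codom ( *%R t) by apply/codomP; exists 0; rewrite mulr0.
have codb : - b \in codom ( *%R t).
  by apply/codomP/ker_rho; rewrite rmorphN rb0 oppr0.
have ker_cod : #|codom ( *%R t)| = #|[pred a | rho a == 0]|.
  apply: eq_card => a; rewrite !inE; apply/codomP/eqP => [ex|/ker_rho //].
  exact/ker_rho.
apply/eqP; have ker_gt0 : (0 < #|[pred a | rho a == 0%R]|)%N.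
  by apply/card_gt0P; exists 0; rewrite inE rmorph0.
rewrite -(eqn_pmul2r ker_gt0) -{1}ker_cod card_fiber_codom //.
by rewrite mulnC card_fiber_rmorphism.
Qed.

Variables (U : finType) (n m : nat) (C : 'I_n -> 'I_m -> U -> F).

(* The solutions (x, v, y) of t y + v M(x) = 0, where M = pencil C. *)
Definition slice_card : nat :=
  \sum_(x : {ffun U -> F}) \sum_(v : 'rV[F]_n)
    #|[pred y : {ffun 'I_m -> F} | [forall j, t * y j + (v *m pencil C x) 0 j == 0]%R]|.

(** For fixed x and v the m coordinates of y are solved independently, which gives |G|^m solutions
    if v M(x) vanishes over [G] and none otherwise. This depends only on the reductions of x and v,
    so both sums descend to [G]; the fibre sizes appear with denominators cleared. *)
Lemma slice_cardE :
  (#|G| ^ (#|U| + n) * slice_card =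
   #|G| ^ m * #|F| ^ (#|U| + n) * total_ker (fun i j u => rho (C i j u)))%N.
Proof.
pose g (x : {ffun U -> G}) (v : 'rV[G]_n) : nat :=
  (v *m pencil (fun i j u => rho (C i j u)) x == 0)%R.
have -> : slice_card = (#|G| ^ m * \sum_(x : {ffun U -> F}) \sum_(v : 'rV[F]_n)
    g [ffun u => rho (x u)] (map_mx rho v))%N.
  rewrite big_distrr; apply: eq_bigr => x _; rewrite big_distrr; apply: eq_bigr => v _ /=.
  rewrite (card_ffun_forall (fun j => [pred a | t * a + (v *m pencil C x) 0 j == 0])).
  under eq_bigr do rewrite card_affine_eq.
  rewrite big_split prod_nat_const card_ord; congr muln.
  have -> : g [ffun u => rho (x u)] (map_mx rho v) = (map_mx rho (v *m pencil C x) == 0).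
    rewrite /g map_mxM; congr (_ *m _ == _ : nat).
    apply/matrixP => i j; rewrite !mxE rmorph_sum; apply: eq_bigr => u _.
    by rewrite rmorphM ffunE.
  have [r0|r0] := eqVneq.
    rewrite big1 // => j _; have /rowP/(_ j) := r0.
    by rewrite mxE [RHS]mxE => ->; rewrite eqxx.
  have /rV0Pn[j] := r0; rewrite mxE => rj0.
  by rewrite (bigD1 j) //= (negbTE rj0).
pose h x := (\sum_(v : 'rV[G]_n) g x v)%N.
have -> : total_ker (fun i j u => rho (C i j u)) = (\sum_x h x)%N.
  by apply: eq_bigr => x _; rewrite card_sum_bool.
rewrite mulnCA -[RHS]mulnA; congr muln.
rewrite !expnD [RHS]mulnAC -sum_comp_ffun -!mulnA; congr muln.
rewrite [RHS]mulnC !big_distrr; apply: eq_bigr => x _ /=.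
exact: sum_comp_rV.
Qed.

End FiberCounting.

(** * The system enlarged by [m] symbols and one row *)

Section Extension.
Variables (F : finComPzRingType) (U Ut : finType) (n m : nat).
Variables (iota : U -> Ut) (s : 'I_m -> Ut).
Hypotheses (iota_inj : injective iota) (s_inj : injective s).
Hypothesis s_range : range s = ~` range iota.

Let symb (z : U + 'I_m) : Ut := match z with inl u => iota u | inr j => s j end.

(** The equation [s_range] supplies both halves: the images of [s] and [iota] are disjoint, and
    together they exhaust [Ut]. *)
Let symb_bij : bijective symb.
Proof.
have disj j u : s j <> iota u.
  have : range s (s j) by exists j.
  by rewrite s_range => sj su; apply: sj; exists u.
have symb_inj : injective symb.
  move=> [u|j] [u'|j'] /=; first by move/iota_inj->.
  - by move=> /esym/disj.
  - by move=> /disj.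
  - by move/s_inj->.
have symb_surj w : w \in codom symb.
  apply/codomP; have [[u _ <-]|nu] := pselect (range iota w); first by exists (inl u).
  have : range s w by rewrite s_range.
  by case=> j _ <-; exists (inr j).
apply: (inj_card_bij symb_inj); rewrite -(card_codom symb_inj).
by apply: subset_leq_card; apply/fintype.subsetP => w _.
Qed.

Lemma card_extended_symbols : #|Ut| = (#|U| + m)%N.
Proof. by rewrite -(bij_eq_card symb_bij) card_sum card_ord. Qed.

(** The map [symb] is inverted by [pick]; the default 0 is never reached, since [symb] is
    surjective. *)
Let glue (p : {ffun U -> F} * {ffun 'I_m -> F}) : {ffun Ut -> F} :=
  [ffun w => if [pick z | symb z == w] is Some z
             then match z with inl u => p.1 u | inr j => p.2 j end else 0].

Let glue_symb p z : glue p (symb z) = match z with inl u => p.1 u | inr j => p.2 j end.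
Proof.
rewrite ffunE; case: pickP => [z' /eqP|/(_ z)]; last by rewrite eqxx.
by move/(bij_inj symb_bij) ->.
Qed.

Let glue_bij : bijective glue.
Proof.
exists (fun x : {ffun Ut -> F} => ([ffun u => x (iota u)], [ffun j => x (s j)])) => [[x y]|x].
  congr (_, _); apply/ffunP => z; rewrite ffunE.
    exact: (glue_symb (x, y) (inl z)).
  exact: (glue_symb (x, y) (inr z)).
apply/ffunP => w; have [w' w'K symbK] := symb_bij.
by rewrite -(symbK w) glue_symb; case: (w' w) => z /=; rewrite ffunE.
Qed.

Variable i0 : 'I_n.+1.

Let insert (p : F * 'rV[F]_n) : 'rV[F]_n.+1 :=
  \row_i if unlift i0 i is Some i' then p.2 0 i' else p.1.

Let insert_bij : bijective insert.
Proof.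
exists (fun v : 'rV[F]_n.+1 => (v 0 i0, \row_i v 0 (lift i0 i))) => [[t v]|v].
  congr (_, _); first by rewrite mxE unlift_none.
  by apply/rowP => i; rewrite !mxE liftK.
by apply/rowP => i; rewrite mxE; case: unliftP => [j ->|-> //]; rewrite mxE.
Qed.

(** In the coordinates given by [glue] and [insert], entry j of the product is t y_j plus entry j of
    [v *m pencil C x]. It remains to move the sum over [t] outermost. *)
Lemma total_ker_extension (C : 'I_n -> 'I_m -> U -> F)
    (M : {ffun Ut -> F} -> 'M[F]_(n.+1, m)) :
  (forall x i j, M x (lift i0 i) j = \sum_u C i j u * x (iota u)) ->
  (forall x j, M x i0 j = x (s j)) ->
  (\sum_x #|[pred v : 'rV[F]_n.+1 | (v *m M x == 0)%R]| = \sum_t slice_card t C)%N.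
Proof.
move=> Mlift M0; rewrite (reindex glue) /=; last exact: onW_bij.
pose S (t : F) (x : {ffun U -> F}) (v : 'rV[F]_n) (y : {ffun 'I_m -> F}) : nat :=
  [forall j, t * y j + (v *m pencil C x) 0 j == 0]%R.
transitivity (\sum_(x : {ffun U -> F}) \sum_(y : {ffun 'I_m -> F}) \sum_t \sum_v S t x v y)%N.
  rewrite pair_big /=; apply: eq_bigr => -[x y] _; rewrite card_sum_bool pair_big /=.
  rewrite (reindex insert) /=; last exact: onW_bij.
  apply: eq_bigr => -[t v] _; rewrite /S /=; congr nat_of_bool.
  have entry j : (insert (t, v) *m M (glue (x, y))) 0 j = t * y j + (v *m pencil C x) 0 j.
    rewrite mxE (bigD1_ord i0) //= mxE unlift_none M0.
    rewrite (glue_symb (x, y) (inr j)) mxE; congr (_ + _).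
    apply: eq_bigr => i _; rewrite mxE liftK Mlift mxE; congr (_ * _).
    by apply: eq_bigr => u _; rewrite (glue_symb (x, y) (inl u)).
  apply/eqP/forallP => [/rowP vM j|vM]; first by rewrite -entry vM mxE.
  by apply/rowP => j; rewrite entry [RHS]mxE; apply/eqP/vM.
transitivity (\sum_(x : {ffun U -> F}) \sum_t \sum_(y : {ffun 'I_m -> F}) \sum_v S t x v y)%N.
  by apply: eq_bigr => x _; exact: exchange_big.
rewrite exchange_big; apply: eq_bigr => t _; apply: eq_bigr => x _.
by rewrite exchange_big; apply: eq_bigr => v _; rewrite card_sum_bool.
Qed.

End Extension.

(** * Power series with a geometric denominator *)

Lemma fps_coefMl (p : {poly rat}) (f : fps rat) k :
  fps_coef (fps_of_poly p * f) k = \sum_(j < k.+1) p`_j * fps_coef f (k - j).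
Proof. by []. Qed.

Lemma fps_coef_1subX (c : rat) (f : fps rat) k :
  fps_coef (fps_of_poly (1 - c *: 'X) * f) k =
  fps_coef f k - (if k is k'.+1 then c * fps_coef f k' else 0).
Proof.
rewrite fps_coefMl big_ord_recl coefB coef1 coefZ coefX mulr0 !subr0 mul1r subn0.
congr (_ + _); case: k => [|k]; first by rewrite big_ord0 oppr0.
rewrite big_ord_recl big1 => [|j _]; rewrite coefB coef1 coefZ coefX /=.
  by rewrite mulr1 sub0r addr0 mulNr subn1.
by rewrite mulr0 subr0 mul0r.
Qed.

(* At [Q = #|O / P|], the number of elements of O / P^k of valuation k - l, for
   any k >= l. *)
Definition valuation_count (Q : rat) (l : nat) : rat :=
  if l is l'.+1 then Q ^+ l - Q ^+ l' else 1.

(** With the denominator cleared, the claim is f_k - r Q f_(k-1) = g_k - r g_(k-1). The weights w_l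
    = N_l r^l satisfy w_(l+1) = r Q w_l for l > 0, so only l = 0 and l = 1 survive, and w_1 - r Q =
    -r. *)
Lemma fps_geometric_quotient (f g : fps rat) (Q r : rat) :
  (forall k, fps_coef f k =
     \sum_(l < k.+1) valuation_count Q l * (r ^+ l * fps_coef g (k - l))) ->
  f = g * (fps_of_poly (1 - r *: 'X) / fps_of_poly (1 - (r * Q) *: 'X)).
Proof.
move=> fE; set num := fps_of_poly _; set den := fps_of_poly _.
have den_unit : den \is a GRing.unit.
  suff : fps_coef den 0 != 0 by [].
  by rewrite [fps_coef _ _]coefB coef1 coefZ coefX mulr0 subr0 oner_eq0.
rewrite mulrA; apply: (canRL (mulrK den_unit)); rewrite mulrC [RHS]mulrC.
apply: fpsP => k; rewrite !fps_coef_1subX !fE.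
case: k => [|k]; first by rewrite big_ord_recl big_ord0 !mul1r addr0 subn0.
rewrite fE !big_ord_recl /= !subn0 !mul1r /bump /= subn1 /= !expr1 expr0.
set S := \sum_(i < k) _; set S' := \sum_(i < k) _.
(* [S] collects the terms l >= 2 of f_(k+1), and [S'] the terms l >= 1 of f_k. *)
have -> : S = r * Q * S'.
  rewrite /S /S' big_distrr; apply: eq_bigr => i _ /=; rewrite !add0n !add1n subSS.
  by rewrite !exprS; ring.
by ring.
Qed.

(** * Valuations in the quotients by powers of P *)

Section Filtration.
Variables (R : idomainType) (P : ideal R) (pi : R).
Hypotheses (P_pi : P = range (fun b => b * pi) :> set R) (P_max : maximal_ideal P).
Hypothesis pi_neq0 : pi != 0.
Variable q : nat.
Hypothesis card_residue : ([set: quo P] #= `I_q)%card.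

Lemma finite_quo_pow k : finite_set [set: quo (ideal_pow P k)].
Proof. by apply/finite_setP; exists (q ^ k)%N; exact: (card_quo_pow P_pi). Qed.

Local Notation fin := finite_quo_pow.
Local Notation Q k := (fquo (fin k)).

Lemma card_Q k : #|{: Q k}| = (q ^ k)%N.
Proof. by apply/card_fquo; exact: (card_quo_pow P_pi). Qed.

Lemma residue_card_gt0 : (0 < q)%N.
Proof.
rewrite -[q]expn1 -(card_Q 1); apply/card_gt0P.
by exists (fproj (fin 1) 0).
Qed.

Lemma red_pow_eq0 k i x : (i <= k)%N ->
  red (fin i) (fproj (fin k) x) = 0 <-> exists b, x = b * pi ^+ i.
Proof.
move=> ik; rewrite red_fproj; last by move=> y; exact: ideal_pow_le.
by rewrite fproj_eq0; exact: ideal_powP.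
Qed.

(* With this convention 0 has valuation k in Q k. *)
Definition has_valuation k i (t : Q k) : Prop :=
  [/\ (i <= k)%N, red (fin i) t = 0 & (i < k)%N -> red (fin i.+1) t <> 0].

(** Write t = u pi^i. For i < k the factor [u] is invertible modulo P^k, so t and pi^i generate the
    same ideal of Q_k, namely the kernel of reduction to Q_i. *)
Lemma has_valuation_ideal k i (t : Q k) (a : Q k) : has_valuation i t ->
  red (fin i) a = 0 <-> exists b, a = t * b.
Proof.
move=> [ik t0 t1]; have [x xE] := fproj_surj t; have [y yE] := fproj_surj a.
move: t0 t1; rewrite xE yE => /(red_pow_eq0 _ ik)[u ux] t1.
split=> [/(red_pow_eq0 _ ik)[w wy]|[b ->]]; last first.
  have [z ->] := fproj_surj b; rewrite -fprojM; apply/(red_pow_eq0 _ ik).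
  by exists (u * z); rewrite ux mulrAC.
(* Valuation k means t = 0; then [a], which vanishes in Q_i = Q_k, is 0 as well. *)
have [kE|ik'] := eqVneq i k.
  exists 0; rewrite mulr0; apply/fproj_eq0/(ideal_powP P_pi).
  by exists w; rewrite wy kE.
have ltik : (i < k)%N by rewrite ltn_neqAle ik'.
(* If [u] were in P, then [t] would vanish in Q_(i+1). *)
have [|v Pv] := maximal_inverse P_max (u := u).
  move=> Pu; apply: (t1 ltik); apply/(red_pow_eq0 _ ltik).
  by move: Pu; rewrite P_pi => -[c _ cE]; exists c; rewrite ux -cE exprS mulrA.
set z := 1 - u * v in Pv.
have [d dE] : exists d, z ^+ k = d * pi ^+ k.
  by move: Pv; rewrite P_pi => -[c _ <-]; exists (c ^+ k); rewrite exprMn.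
(* As u v = 1 - z and z^k lies in P^k, [v] times the truncated geometric series in [z] inverts [u]
   modulo P^k. *)
exists (fproj (fin k) (v * (\sum_(j < k) z ^+ j) * w)); rewrite -fprojM.
apply/fprojP/(ideal_powP P_pi); exists (w * pi ^+ i * d).
have geo : u * v * (\sum_(j < k) z ^+ j) = 1 - z ^+ k.
  have -> : u * v = - (z - 1) by rewrite /z; ring.
  by rewrite mulNr -subrX1 opprB.
rewrite -[RHS]mulrA -dE ux wy -[z ^+ k](subKr 1) -geo; ring.
Qed.

Lemma card_red_ker k i : (i <= k)%N ->
  #|[pred t : Q k | red (fin i) t == 0]| = (q ^ (k - i))%N.
Proof.
move=> ik; have IJ := fun x => @ideal_pow_le R P i k x ik.
pose rho := @red_morphism R _ _ (fin k) (fin i) IJ.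
have rho_surj v : exists u, rho u = v by exact: red_surj.
have := card_fiber_rmorphism rho_surj 0; rewrite !card_Q => cE.
have qi_gt0 : (0 < q ^ i)%N by rewrite expn_gt0 residue_card_gt0.
by apply/eqP; rewrite -(eqn_pmul2r qi_gt0) cE -expnD subnK.
Qed.

(** The elements of valuation at least k - j form the kernel of Q_k -> Q_(k-j). Passing from j to j
    + 1 adds those of valuation exactly k - j - 1, which number q^(j+1) - q^j. The index l is k
    minus the valuation. *)
Lemma sum_by_valuation k (h : Q k -> rat) (g : nat -> rat) :
  (forall i t, has_valuation i t -> h t = g i) ->
  \sum_t h t = \sum_(l < k.+1) valuation_count q%:R l * g (k - l)%N.
Proof.
move=> hg.
have S j : (j <= k)%N -> \sum_(t | red (fin (k - j)) t == 0) h t =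
    \sum_(l < j.+1) valuation_count q%:R l * g (k - l)%N.
  elim: j => [_|j IHj ltjk].
    (* Only the element 0 occurs, of valuation k by convention, with weight 1. *)
    rewrite big_ord_recl big_ord0 addr0 mul1r.
    rewrite (eq_bigr (fun=> g (k - 0)%N)) => [|t /eqP t0]; last first.
      apply: hg; split=> //; first exact: leq_subr.
      by rewrite [X in (X < _)%N]subn0 ltnn.
    by rewrite sumr_const card_red_ker ?leq_subr // subKn.
  have kj : (k - j = (k - j.+1).+1)%N by rewrite subnSK.
  rewrite (bigID (fun t => red (fin (k - j)) t == 0)) /= big_ord_recr /=.
  have sub (t : Q k) : red (fin (k - j)) t == 0 -> red (fin (k - j.+1)) t == 0.
    move=> /eqP t0; apply/eqP; move: t0; have [x ->] := fproj_surj t.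
    move=> /(red_pow_eq0 _ (leq_subr j k))[b ->].
    apply/(red_pow_eq0 _ (leq_subr j.+1 k)).
    by exists (b * pi); rewrite kj exprS mulrA.
  rewrite (eq_bigl (fun t => red (fin (k - j)) t == 0)); last first.
    by move=> t; apply: andb_idl; exact: sub.
  rewrite IHj ?(ltnW ltjk) //; congr (_ + _).
  rewrite (eq_bigr (fun=> g (k - j.+1)%N)) => [|t /andP[/eqP t0 t1]]; last first.
    by apply: hg; split; rewrite ?leq_subr // -kj => _; apply/eqP.
  rewrite sumr_const -[LHS]mulr_natl; congr (_ * _).
  (* The new shell is counted as a difference of two kernels. *)
  have := cardID [pred t : Q k | red (fin (k - j)) t == 0]
    [pred t : Q k | red (fin (k - j.+1)) t == 0].
  rewrite card_red_ker ?leq_subr // subKn //.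
  have -> : #|[predI [pred t : Q k | red (fin (k - j.+1)) t == 0] &
      [pred t : Q k | red (fin (k - j)) t == 0]]| = (q ^ j)%N.
    rewrite -[in RHS](subKn (ltnW ltjk)) -card_red_ker ?leq_subr //.
    by apply: eq_card => t; rewrite !inE; apply: andb_idl; exact: sub.
  move=> /(congr1 (fun c : nat => c%:R : rat)); rewrite natrD !natrX => <-.
  rewrite [RHS]addrC addKr; congr (_%:R).
  by apply: eq_card => t; rewrite !inE andbC.
(* Q_0 is the zero ring, so at j = k the condition on [t] is void. *)
have := S k (leqnn k); rewrite subnn => <-; apply: eq_bigl => t.
have [x ->] := fproj_surj t; apply/esym/eqP/(red_pow_eq0 _ (leq0n k)).
by exists x; rewrite expr0 mulr1.
Qed.

(** * The coefficients [ask] as counts over finite rings *)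

Lemma ask_fquoE (U : finType) (n m : nat) (B : 'M[{malg R[{cmonom U}]}]_(n, m)) k :
  ask P B k =
  (\sum_(x : {ffun U -> Q k})
     #|[pred v : 'rV[Q k]_n | (v *m map_mx (mpeval (fproj (fin k)) x) B == 0)%R]|)%:R
  / (q%:R ^+ k) ^+ #|U|.
Proof.
rewrite /ask (fset_set_finE (T := {ffun U -> Q k})) (fsbig_finE (T := {ffun U -> Q k})).
rewrite natr_sum; congr (_ / _).
  apply: eq_bigr => x _; rewrite (fset_set_finE (T := 'rV[Q k]_n)).
  congr (_%:R); apply: eq_card => v; rewrite !inE.
  by apply/asboolP/eqP.
rewrite -!natrX -card_Q -card_ffun; congr (_%:R).
by apply: eq_card => x; rewrite !inE; apply/asboolP.
Qed.

Definition quo_coef (U : finType) (n m : nat) (c : 'I_n -> 'I_m -> U -> R) k i j u : Q k :=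
  fproj (fin k) (c i j u).

Lemma ask_total_ker (U : finType) (n m : nat) (A : 'M[{malg R[{cmonom U}]}]_(n, m))
    (c : 'I_n -> 'I_m -> U -> R) k :
  (forall i j, A i j = \sum_u c i j u *: mvar R u) ->
  ask P A k = (total_ker (quo_coef c k))%:R / (q%:R ^+ k) ^+ #|U|.
Proof.
move=> AE; rewrite ask_fquoE; apply: (congr1 (fun c : nat => c%:R / _)).
apply: eq_bigr => x _; apply: eq_card => v; rewrite !inE.
suff -> : map_mx (mpeval (fproj (fin k)) x) A = pencil (quo_coef c k) x by [].
apply/matrixP => i j; rewrite !mxE AE.
by rewrite mpeval_lform ?fproj0.
Qed.

(** This is [slice_cardE] for Q_k -> Q_i, whose kernel is t Q_k by [has_valuation_ideal]. The power
    (q^i)^|U| is absorbed as the denominator of the average [ask P A i]. *)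
Lemma slice_card_ask (U : finType) (n m : nat) (A : 'M[{malg R[{cmonom U}]}]_(n, m))
    (c : 'I_n -> 'I_m -> U -> R) k i (t : Q k) :
  (forall i j, A i j = \sum_u c i j u *: mvar R u) ->
  has_valuation i t ->
  (slice_card t (quo_coef c k))%:R =
  (q%:R ^+ i) ^+ m * (q%:R ^+ k) ^+ (#|U| + n) / (q%:R ^+ i) ^+ n * ask P A i :> rat.
Proof.
move=> AE ti; have [ik _ _] := ti.
have IJ := fun x => @ideal_pow_le R P i k x ik.
pose rho := @red_morphism R _ _ (fin k) (fin i) IJ.
have rho_surj v : exists u, rho u = v by exact: red_surj.
have rho_ker a : rho a = 0 <-> exists b, a = t * b by exact: has_valuation_ideal.
have := slice_cardE rho_surj rho_ker (quo_coef c k).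
have -> : total_ker (fun i' j u => rho (quo_coef c k i' j u)) = total_ker (quo_coef c i).
  congr (total_ker _); apply/funext => i'; apply/funext => j; apply/funext => u.
  exact: red_fproj.
rewrite !card_Q => /(congr1 (fun c : nat => c%:R : rat)); rewrite !natrM !natrX => E.
have q_neq0 : q%:R != 0 :> rat by rewrite Num.Theory.pnatr_eq0 -lt0n residue_card_gt0.
rewrite (ask_total_ker _ AE).
have X_neq0 d : (q%:R ^+ i) ^+ d != 0 :> rat by rewrite !expf_neq0.
apply: (mulfI (X_neq0 (#|U| + n)%N)); rewrite E !exprD.
have := X_neq0 n; have := X_neq0 #|U|.
set a := _ ^+ n; set b := _ ^+ #|U| => b_neq0 a_neq0; field.
by rewrite a_neq0 b_neq0.
Qed.

End Filtration.

(** * Assembly of the counts into the identity of series *)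

Theorem theorem10p1 (O : idomainType) (P : ideal O) (q : nat)
    (hO : compact_dvr P) (hq : ([set: quo P] #= `I_q)%card)
    (U : finType) (n m : nat) (A : 'M[{malg O[{cmonom U}]}]_(n, m))
    (hA : forall i j, linear_form (A i j))
    (Ut : finType) (iota : U -> Ut) (iota_inj : injective iota)
    (s : 'I_m -> Ut) (s_inj : injective s) (s_range : range s = ~` range iota)
    (At : 'M[{malg O[{cmonom Ut}]}]_(n.+1, m)) (i0 : 'I_n.+1)
    (hAt : row' i0 At = map_mx (mprename iota) A)
    (hAt0 : forall j, At i0 j = mvar O (s j)) :
  Zask P At =
  Zask P A * (fps_of_poly (1 - (q%:R : rat) ^ (n%:Z - m%:Z) *: 'X)
              / fps_of_poly (1 - (q%:R : rat) ^ (n%:Z - m%:Z + 1) *: 'X)).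
Proof.
have [[pid P_max _ P_neq0] _] := hO.
have [pi P_pi] := pid P.
have pi_neq0 : pi != 0.
  apply/eqP => pi0; apply: P_neq0; rewrite P_pi pi0.
  by apply/seteqP; split=> [_ [b _ <-]|_ ->]; [exact: mulr0|exists 0; rewrite ?mul0r].
have q_neq0 : q%:R != 0 :> rat.
  by rewrite Num.Theory.pnatr_eq0 -lt0n (residue_card_gt0 P_pi pi_neq0 hq).
have [c AE] : exists c : 'I_n -> 'I_m -> U -> O,
    forall i j, A i j = \sum_u c i j u *: mvar O u.
  have rowE i : exists ci : 'I_m -> U -> O, forall j, A i j = \sum_u ci j u *: mvar O u.
    by have [ci ciE] := choice (hA i); exists ci.
  by have [c cE] := choice rowE; exists c.
have -> : (q%:R : rat) ^ (n%:Z - m%:Z + 1) = (q%:R : rat) ^ (n%:Z - m%:Z) * q%:R.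
  by rewrite expfzDr.
(* The exponent n - m may be negative; as [q] is nonzero in [rat], the power splits into a quotient
   with natural exponents. *)
have -> : (q%:R : rat) ^ (n%:Z - m%:Z) = q%:R ^+ n / q%:R ^+ m.
  by rewrite expfzDr // -exprnN.
apply: fps_geometric_quotient => k.
pose fin := finite_quo_pow P_pi pi_neq0 hq.
(* The kernel vectors of the extended system are grouped by their entry [t] at position [i0]. *)
transitivity ((\sum_(t : fquo (fin k)) slice_card t (fun i j u => fproj (fin k) (c i j u)))%:R
    / (q%:R ^+ k) ^+ #|Ut| : rat).
  rewrite [LHS](ask_fquoE P_pi pi_neq0 hq); apply: (congr1 (fun c : nat => c%:R / _)).
  apply: (total_ker_extension iota_inj s_inj s_range (i0 := i0)) => [x i j|x j]; last first.
    by rewrite mxE hAt0 mpeval_mvar ?fproj0.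
  have -> : map_mx (mpeval (fproj (fin k)) x) At (lift i0 i) j =
      mpeval (fproj (fin k)) x (row' i0 At i j) by rewrite !mxE.
  by rewrite hAt mxE AE mprename_lform mpeval_lform ?fproj0.
rewrite natr_sum (sum_by_valuation (g := fun i =>
  (q%:R ^+ i) ^+ m * (q%:R ^+ k) ^+ (#|U| + n) / (q%:R ^+ i) ^+ n * ask P A i)).
  rewrite (card_extended_symbols iota_inj s_inj s_range) mulr_suml; apply: eq_bigr => l _.
  rewrite -[LHS]mulrA; congr (_ * _); set i := (k - l)%N.
  (* What remains is (q^i)^m (q^k)^(|U|+n) / ((q^i)^n (q^k)^(|U|+m)) = r^l, where k = l + i. *)
  have -> : q%:R ^+ k = q%:R ^+ l * q%:R ^+ i :> rat by rewrite -exprD subnKC // -ltnS.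
  rewrite expr_div_n (exprAC _ n l) (exprAC _ m l) !exprD !exprMn.
  have Q_neq0 (a d : nat) : (q%:R ^+ a) ^+ d != 0 :> rat by rewrite !expf_neq0.
  (* The powers become independent nonzero variables for [field]. *)
  move: (Q_neq0 i m) (Q_neq0 i n) (Q_neq0 i #|U|) (Q_neq0 l m) (Q_neq0 l #|U|).
  move: ((_ ^+ i) ^+ m) ((_ ^+ i) ^+ n) ((_ ^+ i) ^+ #|U|) ((_ ^+ l) ^+ m)
    ((_ ^+ l) ^+ #|U|) => z1 z2 z3 z4 z5 h1 h2 h3 h4 h5.
  rewrite -[fps_coef _ _]/(ask P A i).
  by field; rewrite h1 h2 h3 h4 h5.
by move=> i t; exact: slice_card_ask.
Qed.
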